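(* For $3\le D\le 20000$ there is no graph of degree $13$, diameter $D$ and cyclic defect. Furthermore, for odd $g$ with $7\le g\le 40001$ there is no graph of degree $13$, girth $g$ and cyclic excess.
   Context: For an integer $d\ge 1$ define polynomials $G_{d,m}(x)$ by $G_{d,0}(x)=1$, $G_{d,1}(x)=x+1$, and $G_{d,m+1}(x)=xG_{d,m}(x)-(d-1)G_{d,m-1}(x)$ for $m\ge1$. Let $J_n$ be the $n\times n$ all-ones matrix. For a graph on $n\ge3$ vertices, a cycle matrix is the adjacency matrix $B$ of an $n$-cycle on the same vertex set (i.e., for some ordering $v_1,\dots,v_n$ of the vertices, $B_{ij}=1$ iff $v_i,v_j$ are cyclically consecutive, and $0$ otherwise); this cycle need not consist of edges of the graph. A graph $\Gamma$ of order $n$ with adjacency matrix $A$ is a graph of degree $d$, diameter $D$ and cyclic defect if $\Gamma$ is $d$-regular with $d\ge3$, has diameter $D\ge2$, and $G_{d,D}(A)=J_n+B$ for some cycle matrix $B$. It is a graph of degree $d$, girth $g$ and cyclic excess if $\Gamma$ is $d$-regular with $d\ge3$, has odd girth $g\ge5$, and $G_{d,\lfloor g/2\rfloor}(A)=J_n-B$ for some cycle matrix $B$. *)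

(* Defs.v *)
From HB Require Import structures.
From mathcomp Require Import all_boot all_order all_fingroup all_algebra.

Set Implicit Arguments.
Unset Strict Implicit.
Unset Printing Implicit Defensive.

Import GRing.Theory.

Definition simple_graph (T : finType) (e : rel T) : Prop :=
  symmetric e /\ irreflexive e.

Definition regular (T : finType) (e : rel T) (d : nat) : Prop :=
  forall x : T, #|[set y | e x y]| = d.

Definition walk_of_length (T : finType) (e : rel T) (x y : T) (k : nat) : Prop :=
  exists p : seq T, [/\ path e x p, last x p = y & size p = k].

Definition at_distance (T : finType) (e : rel T) (x y : T) (k : nat) : Prop :=
  walk_of_length e x y k /\ (forall l, walk_of_length e x y l -> k <= l).

(* The first clause forces connectedness. *)
Definition has_diameter (T : finType) (e : rel T) (D : nat) : Prop :=
  (forall x y : T, exists2 k, k <= D & at_distance e x y k) /\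
  (exists x y : T, at_distance e x y D).

(* ucycleb alone would accept a single edge, as the closed walk [:: x; y]. *)
Definition graph_cycle (T : finType) (e : rel T) (c : seq T) : Prop :=
  ucycleb e c /\ 3 <= size c.

Definition has_girth (T : finType) (e : rel T) (g : nat) : Prop :=
  (exists2 c : seq T, graph_cycle e c & size c = g) /\
  (forall c : seq T, graph_cycle e c -> g <= size c).

Local Open Scope ring_scope.

Definition adjacency_mx (n : nat) (e : rel 'I_n) : 'M[int]_n :=
  \matrix_(i, j) (e i j)%:R.

(* The permutation v lists the vertices in cyclic order; ordS is the cyclic
   successor on 'I_n. *)
Definition cycle_mx (n : nat) (B : 'M[int]_n) : Prop :=
  (3 <= n)%N /\
  exists v : 'S_n,
    forall i j : 'I_n, B (v i) (v j) = ((j == ordS i) || (i == ordS j))%:R.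

Fixpoint G (d m : nat) : {poly int} :=
  match m with
  | 0%N => 1
  | m1.+1 =>
    match m1 with
    | 0%N => 'X + 1
    | m2.+1 => 'X * G d m1 - (d%:Z - 1)%:P * G d m2
    end
  end.

(* The order is written n.+1 because horner_mx needs a nonzero dimension. *)
Definition cyclic_defect (n : nat) (e : rel 'I_n.+1) (d D : nat) : Prop :=
  [/\ simple_graph e,
      regular e d /\ (3 <= d)%N,
      has_diameter e D /\ (2 <= D)%N
    & exists2 B : 'M[int]_n.+1, cycle_mx B &
        horner_mx (adjacency_mx e) (G d D) = const_mx 1 + B].

Definition cyclic_excess (n : nat) (e : rel 'I_n.+1) (d g : nat) : Prop :=
  [/\ simple_graph e,
      regular e d /\ (3 <= d)%N,
      [/\ has_girth e g, odd g & (5 <= g)%N]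
    & exists2 B : 'M[int]_n.+1, cycle_mx B &
        horner_mx (adjacency_mx e) (G d g./2) = const_mx 1 - B].

(* Main.v *)
(** The cyclic order of [B] makes the alternating sign vector [w] span the
    eigenspace of [B] for [-2]; it is defined because the order [n] is even,
    which is read off [G_{13,m}(13) = n + 2s] with [s = 1] for a defect and
    [s = -1] for an excess. As [A] commutes with [J] and with [G_{13,m}(A)], it
    preserves this line, so [A w = a w] with [a] an integer, and
    [G_{13,m}(a) = -2s]. The recurrence modulo 3 excludes the value [-2], while
    the value [2] forces [a = 1 mod 12]; the values grow exponentially when
    [|a| >= 8], and [G_{13,m}(1) = 14 mod 24]. *)

Require Import Defs.
From mathcomp Require Import all_boot all_order all_fingroup all_algebra.
From mathcomp Require Import zify ring.

Set Implicit Arguments.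
Unset Strict Implicit.
Unset Printing Implicit Defensive.

Import Order.TTheory GRing.Theory Num.Theory.

Local Open Scope ring_scope.

(** * Eigenvectors of a cycle matrix for 2 and -2 *)

Section CycleMatrix.

Variables (n : nat) (B : 'M[int]_n.+1) (v : 'S_n.+1).
Hypothesis n_ge3 : (3 <= n.+1)%N.
Hypothesis Bv : forall i j : 'I_n.+1,
  B (v i) (v j) = ((j == ordS i) || (i == ordS j))%:R.

(** Equality would give [i + 2 = i] modulo [n.+1], impossible for order at least 3. Hence each row
    of [B] has two distinct ones. *)
Lemma ordS_neq_ord_pred (i : 'I_n.+1) : ordS i != ord_pred i.
Proof.
apply/eqP => /(congr1 (@ordS n.+1)); rewrite ord_predK => /(congr1 val) /=.
have := ltn_ord i; move: n_ge3; rewrite -[(_ %% _).+1]addn1 modnDml addn1.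
case: (ltngtP (i.+2) n.+1) => [h|h|h] n3 i_lt.
- by rewrite modn_small //; lia.
- have ->: (i.+2 = 1 + n.+1)%N by lia.
  by rewrite modnDr modn_small //; lia.
- by rewrite h modnn; lia.
Qed.

Lemma cycle_mx_mul_col (w : 'cV[int]_n.+1) (i : 'I_n.+1) :
  (B *m w) (v i) 0 = w (v (ordS i)) 0 + w (v (ord_pred i)) 0.
Proof.
rewrite mxE (reindex_inj (@perm_inj _ v)) /=.
rewrite (bigD1 (ordS i)) //= (bigD1 (ord_pred i)) /=; last first.
  by rewrite eq_sym ordS_neq_ord_pred.
rewrite !Bv eqxx mul1r ord_predK eqxx orbT mul1r big1 ?addr0 // => j /andP[h1 h2].
rewrite Bv (negbTE h1) /= (_ : (i == ordS j) = false) ?mul0r //.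
by apply/negbTE; apply: contra h2 => /eqP ->; rewrite ordSK.
Qed.

Lemma cycle_mx_mul_const : B *m const_mx 1 = 2 *: (const_mx 1 : 'cV_n.+1).
Proof.
apply/colP => k; rewrite -(permKV v k) cycle_mx_mul_col !mxE.
by lia.
Qed.

(* The hypothesis gives [\sum_i (w_i + w_(i+1))^2 = \sum_i w_i (2 w_i +
   w_(i+1) + w_(i-1)) = 0]. *)
Lemma cycle_mx_eigenN2 (w : 'cV[int]_n.+1) (i : 'I_n.+1) :
  B *m w = -2 *: w -> w (v (ordS i)) 0 = - w (v i) 0.
Proof.
move=> Bw; pose x k := w (v k) 0.
have rec k : x (ordS k) + x (ord_pred k) = - 2 * x k.
  by rewrite /x -cycle_mx_mul_col Bw !mxE.
have sh (f : 'I_n.+1 -> int) : \sum_k f (ordS k) = \sum_k f k.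
  by rewrite [RHS](reindex_inj (@ordS_inj n.+1)).
have sq0 : \sum_k (x k + x (ordS k)) ^+ 2 = 0.
  have -> : \sum_k (x k + x (ordS k)) ^+ 2 =
     \sum_k x k ^+ 2 + \sum_k x (ordS k) ^+ 2
     + \sum_k x k * x (ordS k) + \sum_k x (ordS k) * x (ord_pred (ordS k)).
    rewrite -!big_split /=; apply: eq_bigr => k _; rewrite ordSK; ring.
  rewrite (sh (fun k => x k ^+ 2)) (sh (fun k => x k * x (ord_pred k))).
  rewrite -!big_split /= big1 // => k _.
  have -> : x (ord_pred k) = - 2 * x k - x (ordS k) by rewrite -(rec k); ring.
  ring.
have /eqP := sq0; rewrite psumr_eq0 => [|k _]; last exact: sqr_ge0.
move/allP/(_ i); rewrite mem_index_enum => /(_ isT) /=.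
by rewrite sqrf_eq0 addrC addr_eq0 => /eqP.
Qed.

(** [(v^-1)%g k] is the position of the vertex [k] on the cycle. *)
Definition alternating_col : 'cV[int]_n.+1 := \col_k (-1) ^+ ((v^-1)%g k).

Lemma alternating_colE i : alternating_col (v i) 0 = (-1) ^+ i.
Proof. by rewrite mxE permK. Qed.

(** Reduction modulo an even [n.+1] keeps parity, so the sign also flips at the wrap to 0. *)
Lemma sign_ordS (i : 'I_n.+1) : ~~ odd n.+1 ->
  (-1) ^+ (ordS i) = - (-1) ^+ i :> int.
Proof.
move=> n_even; rewrite -[RHS]mulN1r -exprS -signr_odd -[RHS]signr_odd /=.
by rewrite odd_mod // (negbTE n_even).
Qed.

Lemma cycle_mx_mul_alternating : ~~ odd n.+1 ->
  B *m alternating_col = -2 *: alternating_col.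
Proof.
move=> n_even; apply/colP => k; rewrite -(permKV v k) cycle_mx_mul_col [RHS]mxE.
rewrite !alternating_colE sign_ordS //; move: ((v^-1)%g k) => i.
by have := sign_ordS (ord_pred i) n_even; rewrite ord_predK => ->; ring.
Qed.

Lemma sum_alternating : ~~ odd n.+1 -> \sum_k alternating_col k 0 = 0.
Proof.
move=> n_even; rewrite (reindex_inj (@perm_inj _ v)) /=.
(* A shift along the cycle permutes the terms and negates each of them. *)
set S := \sum_k _; have : S = - S.
  rewrite {1}/S (reindex_inj (@ordS_inj n.+1)) -sumrN; apply: eq_bigr => i _.
  by rewrite !alternating_colE sign_ordS.
by move/eqP; rewrite -subr_eq0 opprK -mulr2n mulrn_eq0 => /eqP.
Qed.

Lemma cycle_mx_eigenspaceN2 (w : 'cV[int]_n.+1) :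
  B *m w = -2 *: w -> w = w (v ord0) 0 *: alternating_col.
Proof.
move=> Bw.
(* Every position is reached from 0 without wrapping, so the entry at [v ord0] determines [w]. *)
have w_sign k (k_lt : (k < n.+1)%N) :
    w (v (Ordinal k_lt)) 0 = (-1) ^+ k * w (v ord0) 0.
  elim: k k_lt => [|k IHk] k_lt.
    by rewrite mul1r; congr (w (v _) 0); apply: val_inj.
  rewrite (_ : Ordinal k_lt = ordS (Ordinal (ltnW k_lt))); last first.
    by apply: val_inj; rewrite /= modn_small.
  by rewrite cycle_mx_eigenN2 // IHk exprS mulN1r mulNr.
apply/colP => k; rewrite -(permKV v k) mxE alternating_colE mulrC.
by case: ((v^-1)%g k) => j j_lt; rewrite w_sign.
Qed.

End CycleMatrix.

(** * Eigenvectors of the adjacency matrix *)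

Lemma horner_mx_eigen (R : comNzRingType) (n : nat) (A : 'M[R]_n.+1)
    (w : 'cV[R]_n.+1) (a : R) (p : {poly R}) :
  A *m w = a *: w -> horner_mx A p *m w = p.[a] *: w.
Proof.
move=> Aw; elim/poly_ind: p => [|p c IHp].
  by rewrite rmorph0 mul0mx horner0 scale0r.
rewrite rmorphD rmorphM /= horner_mx_X horner_mx_C mulmxDl -mulmxE -mulmxA Aw.
by rewrite -scalemxAr IHp mul_scalar_mx scalerA -scalerDl hornerMXaddC mulrC.
Qed.

Section RegularGraph.

Variables (n d : nat) (e : rel 'I_n.+1).
Hypotheses (e_simple : simple_graph e) (e_regular : regular e d).

Let A := adjacency_mx e.

Lemma adjacency_mx_const : A *m const_mx 1 = d%:Z *: (const_mx 1 : 'cV_n.+1).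
Proof.
apply/colP => i; rewrite !mxE mulr1 -(e_regular i) -sum1_card.
rewrite (big_morph Posz PoszD (erefl : Posz 0 = 0)) [RHS]big_mkcond; apply: eq_bigr => j _.
by rewrite !mxE mulr1 inE; case: (e i j).
Qed.

(** By symmetry the columns of [A] also sum to [d]. Thus [A] preserves the vectors of sum zero,
    which are those killed by the all-ones matrix. *)
Lemma sum_adjacency_mx_col (w : 'cV[int]_n.+1) :
  \sum_i (A *m w) i 0 = d%:Z * \sum_i w i 0.
Proof.
under eq_bigr do rewrite mxE.
rewrite exchange_big /= mulr_sumr; apply: eq_bigr => j _.
rewrite -mulr_suml; congr (_ * _).
have /colP/(_ j) := adjacency_mx_const; rewrite !mxE mulr1 => <-.
by apply: eq_bigr => i _; rewrite !mxE mulr1 e_simple.1.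
Qed.

Lemma const_mx_mul_col (w : 'cV[int]_n.+1) :
  (const_mx 1 : 'M_n.+1) *m w = const_mx (\sum_i w i 0).
Proof.
by apply/colP => i; rewrite !mxE; apply: eq_bigr => j _; rewrite mxE mul1r.
Qed.

(** Both sides of the matrix equation are applied to the all-ones vector, an eigenvector of [A], [J]
    and [B] for [d], [n.+1] and 2. *)
Lemma horner_degree_cyclic (B : 'M[int]_n.+1) (s : int) (p : {poly int}) :
    cycle_mx B -> horner_mx A p = const_mx 1 + s *: B ->
  p.[d%:Z] = n.+1%:Z + 2 * s.
Proof.
move=> [n_ge3 [v Bv]] pA.
have := horner_mx_eigen p adjacency_mx_const.
rewrite pA mulmxDl -scalemxAl (cycle_mx_mul_const n_ge3 Bv) const_mx_mul_col.
move=> /colP/(_ 0); rewrite !mxE !mulr1.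
under eq_bigr do rewrite mxE.
by rewrite sumr_const card_ord => <-; rewrite natz; ring.
Qed.

Lemma horner_eigen_cyclic (B : 'M[int]_n.+1) (s : int) (p : {poly int}) :
    s != 0 -> ~~ odd n.+1 ->
    cycle_mx B -> horner_mx A p = const_mx 1 + s *: B ->
  exists a : int, p.[a] = -2 * s.
Proof.
move=> s_neq0 n_even [n_ge3 [v Bv]] pA.
have Bw := cycle_mx_mul_alternating n_ge3 Bv n_even.
have w0 := sum_alternating v n_even.
set w := alternating_col v in Bw w0.
have pw : horner_mx A p *m w = (-2 * s) *: w.
  rewrite pA mulmxDl const_mx_mul_col w0 -scalemxAl Bw scalerA mulrC.
  by apply/colP => i; rewrite !mxE add0r.
(* [A] commutes with [horner_mx A p] and [J] kills [A *m w]; cancelling [s] leaves the claim about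
   [B]. *)
have BAw : B *m (A *m w) = -2 *: (A *m w).
  have : horner_mx A p *m (A *m w) = (-2 * s) *: (A *m w).
    have cA : comm_mx A (horner_mx A p) by apply: comm_mx_horner.
    by rewrite mulmxA -cA -mulmxA pw scalemxAr.
  rewrite pA mulmxDl const_mx_mul_col sum_adjacency_mx_col w0 mulr0.
  rewrite (_ : const_mx 0 = 0) ?add0r -?scalemxAl; last exact/matrixP.
  rewrite mulrC -scalerA => /matrixP E; apply/matrixP => i j.
  by have := E i j; rewrite !mxE; apply: mulfI.
have Aw := cycle_mx_eigenspaceN2 n_ge3 Bv BAw.
(* As [w] is 1 at [v ord0], this entry is the eigenvalue. *)
exists ((A *m w) (v ord0) 0); have := horner_mx_eigen p Aw.
rewrite pw => /colP/(_ (v ord0)); rewrite !mxE permK.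
by rewrite expr0 !mulr1 => <-.
Qed.

End RegularGraph.

(** * Integer values of the polynomials for degree 13 *)

Lemma horner_GSS (d m : nat) (a : int) :
  (G d m.+2).[a] = a * (G d m.+1).[a] - (d%:Z - 1) * (G d m).[a].
Proof. by rewrite /= !hornerE. Qed.

Lemma horner_G0 d (a : int) : (G d 0).[a] = 1.
Proof. by rewrite /= hornerE. Qed.

Lemma horner_G1 d (a : int) : (G d 1).[a] = a + 1.
Proof. by rewrite /= !hornerE. Qed.

Lemma horner_G13SS (m : nat) (a : int) :
  (G 13 m.+2).[a] = a * (G 13 m.+1).[a] - 12 * (G 13 m).[a].
Proof. exact: horner_GSS. Qed.

(** Since 3 divides 12, the value is [a ^+ m.+1 * (a + 1)] modulo 3. *)
Lemma horner_G13_mod3 (m : nat) (a : int) :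
  (exists k, (G 13 m.+2).[a] = 3 * k) \/
  (exists b k, a = 3 * b + 1 /\ (G 13 m.+2).[a] = 3 * k + 2).
Proof.
elim: m => [|m IHm]; rewrite horner_G13SS.
  rewrite horner_G0 horner_G1.
  have [b ab] : exists b, a = 3 * b \/ a = 3 * b + 1 \/ a = 3 * b + 2.
    exists (a %/ 3)%Z; lia.
  case: ab => [|[]] ->; [left|right|left].
  - exists (b * (3 * b + 1) - 4); ring.
  - exists b, (3 * b ^+ 2 + 3 * b - 4); split=> //; ring.
  - exists ((3 * b + 2) * (b + 1) - 4); ring.
set z := (G 13 m.+1).[a]; case: IHm => [[k ->]|[b [k [-> ->]]]].
  left; exists (a * k - 4 * z); ring.
right; exists b, ((3 * b + 1) * k + 2 * b - 4 * z); split=> //; ring.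
Qed.

(** Modulo 4 the value is [a ^+ m.+2 * (a + 1)]. The index starts at 3 so that the power of [a] is
    at least a square, hence 0 modulo 4 for every even [a]. *)
Lemma horner_G13_mod4 (m : nat) (a : int) :
  (exists k, (G 13 m.+3).[a] = 4 * k) \/
  (exists b k, a = 4 * b + 1 /\ (G 13 m.+3).[a] = 4 * k + 2).
Proof.
elim: m => [|m IHm]; rewrite horner_G13SS.
  rewrite horner_G13SS horner_G0 horner_G1.
  have [b ab] : exists b, a = 2 * b \/ a = 4 * b + 1 \/ a = 4 * b + 3.
    case: (boolP (2 %| a)%Z) => a_even; [exists (a %/ 2)%Z|exists (a %/ 4)%Z]; lia.
  case: ab => [|[]] ->; [left|right|left].
  - exists (b * (b * (2 * b + 1) - 6) - 3 * (2 * b + 1)); ring.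
  - exists b, ((4 * b + 1) * ((4 * b + 1) * b + 2 * b - 3) - 3 * (4 * b + 2) + 2 * b).
    split=> //; ring.
  - exists ((4 * b + 3) * ((4 * b + 3) * (b + 1) - 3) - 12 * (b + 1)); ring.
set z := (G 13 m.+2).[a]; case: IHm => [[k ->]|[b [k [-> ->]]]].
  left; exists (a * k - 3 * z); ring.
right; exists b, ((4 * b + 1) * k + 2 * b - 3 * z); split=> //; ring.
Qed.

(** With [y], [z] the values at [m.+1], [m], induction gives [12 * |z| <= 6 * |y|], and [8 - 6 = 2]
    restores the factor 2. *)
Lemma horner_G13_growth (m : nat) (a : int) :
  8 <= `|a| -> 1 <= `|(G 13 m).[a]| /\
    2 * `|(G 13 m).[a]| <= `|(G 13 m.+1).[a]|.
Proof.
move=> a_ge8; elim: m => [|m [IH1 IH2]].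
  by rewrite horner_G0 horner_G1; split; lia.
split; first by lia.
rewrite horner_G13SS; move: IH1 IH2.
set y := (G 13 m.+1).[a]; set z := (G 13 m).[a] => IH1 IH2.
have ay : 8 * `|y| <= `|a * y| by rewrite normrM ler_wpM2r.
lia.
Qed.

(** The residue 14 is stable: [14 - 12 * 14 = 14 - 7 * 24]. *)
Lemma horner_G13_at1 (m : nat) : exists k, (G 13 m.+2).[1] = 24 * k + 14.
Proof.
elim/ltn_ind: m => -[|[|m]] IHm.
- by exists (- 1); rewrite horner_G13SS horner_G0 horner_G1.
- by exists (- 2); rewrite !horner_G13SS horner_G0 horner_G1.
have [k Ek] := IHm m.+1 (ltnSn _); have [l El] := IHm m (ltnW (ltnSn _)).
by exists (k - 12 * l - 7); rewrite horner_G13SS Ek El; ring.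
Qed.

Lemma horner_G13_neqN2 (m : nat) (a : int) : (G 13 m.+2).[a] <> - 2.
Proof. by case: (horner_G13_mod3 m a) => [[k ->]|[b [k [_ ->]]]]; lia. Qed.

Lemma horner_G13_neq2 (m : nat) (a : int) : (G 13 m.+3).[a] <> 2.
Proof.
move=> G2.
(* For large [a], two doublings from an absolute value of at least 1 give at least 4. *)
have [a_ge8|a_lt8] := lerP 8 `|a|.
  have [] := horner_G13_growth m.+2 a_ge8; rewrite G2.
  have [] := horner_G13_growth m.+1 a_ge8; lia.
(* The value 2 selects the residue 1 of [a] modulo both 3 and 4, and only 1 has it among the
   integers from -7 to 7. *)
have a1 : a = 1.
  have := horner_G13_mod3 m.+1 a; have := horner_G13_mod4 m a; rewrite G2.
  by case=> [[k]|[b [k [ab _]]]] => [|[[l]|[c [l [ac _]]]]]; lia.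
by have [k] := horner_G13_at1 m.+1; rewrite -a1 G2; lia.
Qed.

Lemma horner_G13_at13_even (m : nat) : exists k, (G 13 m.+1).[13] = 2 * k.
Proof.
elim: m => [|m [k Ek]]; first by exists 7; rewrite horner_G1.
exists (13 * k - 6 * (G 13 m).[13]); rewrite horner_G13SS Ek; ring.
Qed.

(** * Nonexistence for defect and excess *)

Lemma no_cyclic_deviation (n m : nat) (e : rel 'I_n.+1) (B : 'M[int]_n.+1)
    (s : int) :
    simple_graph e -> regular e 13 -> cycle_mx B -> s = 1 \/ s = -1 ->
  horner_mx (adjacency_mx e) (G 13 m.+3) <> const_mx 1 + s *: B.
Proof.
move=> e_simple e_reg cB s1 GA.
have Gd := horner_degree_cyclic e_reg cB GA.
have n_even : ~~ odd n.+1.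
  by have [k] := horner_G13_at13_even m.+2; rewrite Gd; lia.
have s_neq0 : s != 0 by case: s1 => ->.
have [a] := horner_eigen_cyclic e_simple e_reg s_neq0 n_even cB GA.
by case: s1 => ->; [exact: horner_G13_neqN2 | exact: horner_G13_neq2].
Qed.

Local Close Scope ring_scope.

Theorem theorem10 :
  (forall D : nat, 3 <= D <= 20000 ->
     ~ exists (n : nat) (e : rel 'I_n.+1), cyclic_defect e 13 D) /\
  (forall g : nat, odd g -> 7 <= g <= 40001 ->
     ~ exists (n : nat) (e : rel 'I_n.+1), cyclic_excess e 13 g).
Proof.
split=> [[|[|[|m]]] // _|g g_odd /andP[g_ge7 _]] [n [e]].
  case=> e_simple [e_reg _] _ [B cB GA].
  apply: (no_cyclic_deviation (m := m) (s := 1%R) e_simple e_reg cB).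
    by left.
  by rewrite GA scale1r.
case=> e_simple [e_reg _] _ [B cB].
(* The bound [7 <= g] is what makes the index [g./2] at least 3. *)
have [m ->] : exists m, g./2 = m.+3 by exists (g./2 - 3); lia.
move=> GA; apply: (no_cyclic_deviation (m := m) (s := (-1)%R) e_simple e_reg cB).
  by right.
by rewrite GA scaleN1r.
Qed.
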